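(* Let $(X,\mathbb{X},\mu)$ be a measure space and let $p\in[1,\infty)$. Let $(f_n)$ be a sequence of measurable functions on $X$ that $\alpha_p$-converges to a measurable function $f$. Then $(f_n)$ converges to $f$ in measure.
   Context: Measurable functions are $\mathbb{X}$-measurable real-valued functions on $X$; $(X,\mathbb{X},\mu)$ is an arbitrary measure space. For $B\in\mathbb{X}$, $B^c$ denotes the complement of $B$ in $X$. A sequence $(f_n)$ of measurable functions is said to $\alpha_p$-converge to a measurable function $f$, written $f_n\xrightarrow{\alpha_p}f$, if there exists a sequence of measurable sets $(B_n)$ with $\mu(B_n^c)\to 0$ as $n\to\infty$ such that $\int_{B_n}|f_n-f|^p\,d\mu\to 0$ as $n\to\infty$. The sequence $(f_n)$ converges to $f$ in measure if for every $\delta>0$, $\mu(\{x\in X : |f_n(x)-f(x)|\ge\delta\})\to 0$ as $n\to\infty$. *)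

(* Defs.v *)
From HB Require Import structures.
From mathcomp Require Import all_boot all_order all_algebra.
From mathcomp Require Import all_classical all_reals all_analysis.
Import Order.TTheory GRing.Theory Num.Theory.
Import numFieldNormedType.Exports.

Set Implicit Arguments.
Unset Strict Implicit.
Unset Printing Implicit Defensive.

Local Open Scope classical_set_scope.
Local Open Scope ring_scope.
Local Open Scope ereal_scope.

Definition alpha_cvg (d : measure_display) (T : measurableType d) (R : realType)
    (mu : {measure set T -> \bar R}) (p : R)
    (f_ : nat -> {mfun T >-> R}) (f : {mfun T >-> R}) : Prop :=
  exists B : nat -> set T,
    [/\ forall n, measurable (B n),
        mu (~` B n) @[n --> \oo] --> 0 &
        \int[mu]_(x in B n) (`|f_ n x - f x|%R `^ p)%:E @[n --> \oo] --> 0].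

Definition cvg_in_measure (d : measure_display) (T : measurableType d)
    (R : realType) (mu : {measure set T -> \bar R})
    (f_ : nat -> {mfun T >-> R}) (f : {mfun T >-> R}) : Prop :=
  forall delta : R, (0 < delta)%R ->
    mu [set x | (delta <= `|f_ n x - f x|)%R] @[n --> \oo] --> 0.

(* Main.v *)
Require Import Defs.
From mathcomp Require Import all_boot all_order all_algebra.
From mathcomp Require Import all_classical all_reals all_analysis.
From mathcomp Require Import measurable_realfun.
Import Order.TTheory GRing.Theory Num.Theory.
Local Open Scope classical_set_scope.
Local Open Scope ring_scope.

(** The set where [f_ n] and [f] differ by at least [delta] is covered by its
    trace on [B n] and by the complement of [B n].  The complement has measure
    tending to 0, while on [B n] Chebyshev's inequality for the [p]-th power
    ([chebyshev_powR]) bounds the measure of the trace by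
    [delta `^ - p] times the integral of [`|f_ n - f| `^ p] over [B n].  So
    [measure_dist_ge_le] dominates the measure of the whole set by a sum of two
    sequences tending to 0, and the squeeze theorem concludes. *)

(** Monotonicity of [powR ^~ p] on nonnegative reals turns the level set of
    [`|h|] at [delta] into part of the level set of [`|h| `^ p] at
    [delta `^ p], to which Markov's inequality applies. *)
Lemma chebyshev_powR (d : measure_display) (T : measurableType d)
    (R : realType) (mu : {measure set T -> \bar R}) (p delta : R)
    (D : set T) (h : T -> R) :
  0 <= p -> 0 < delta -> measurable D -> measurable_fun D h ->
  ((delta `^ p)%:E * mu (D `&` [set x | (delta <= `|h x|)%R])
     <= \int[mu]_(x in D) (`|h x| `^ p)%:E)%E.
Proof.
move=> p0 delta0 mD mh.
have mnormh : measurable_fun D (fun x => `|h x|) by exact: measurableT_comp.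
have mhp : measurable_fun D (fun x => (`|h x| `^ p)%:E).
  apply/measurable_EFinP.
  exact: (@measurableT_comp _ _ _ _ _ _ (@powR R ^~ p)).
have dp0 : 0 < delta `^ p by exact: powR_gt0.
have := @le_integral_abse _ _ _ mu D mD _ (delta `^ p) mhp dp0.
under eq_integral do rewrite gee0_abs ?lee_fin ?powR_ge0//.
apply: le_trans; apply: lee_wpmul2l; first by rewrite lee_fin ltW.
apply: le_measure; rewrite ?inE.
- exact: measurable_fun_le.
- by apply: emeasurable_fun_c_infty => //; exact: measurableT_comp.
- move=> x [Dx dh]; split => //=; rewrite lee_fin ger0_norm ?powR_ge0//.
  by apply: ge0_ler_powR => //; rewrite nnegrE// ltW.
Qed.

Lemma measure_dist_ge_le (d : measure_display) (T : measurableType d)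
    (R : realType) (mu : {measure set T -> \bar R}) (p delta : R)
    (D : set T) (h : T -> R) :
  0 <= p -> 0 < delta -> measurable D -> measurable_fun setT h ->
  (mu [set x | (delta <= `|h x|)%R]
     <= (delta `^ p)^-1%:E * \int[mu]_(x in D) (`|h x| `^ p)%:E
        + mu (~` D))%E.
Proof.
move=> p0 delta0 mD mh; set A := [set x | _].
have mA : measurable A.
  rewrite -[A]setTI; apply: measurable_fun_le => //.
  exact: measurableT_comp.
have mDA : measurable (D `&` A) by exact: measurableI.
have mDC : measurable (~` D) by exact: measurableC.
have AD : A `<=` (D `&` A) `|` ~` D.
  by move=> x Ax; have [Dx|Dx] := pselect (D x); [left|right].
apply: (@le_trans _ _ (mu ((D `&` A) `|` ~` D))).
  by apply: le_measure => //; rewrite inE//; exact: measurableU.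
apply: le_trans (measureU2 _ mDA mDC) _.
apply: leeD => //; rewrite lee_pdivlMl ?powR_gt0//.
by apply: chebyshev_powR => //; exact: measurable_funS mh.
Qed.

Theorem proposition2p4 (d : measure_display) (T : measurableType d)
    (R : realType) (mu : {measure set T -> \bar R}) (p : R) (hp : 1 <= p)
    (f_ : nat -> {mfun T >-> R}) (f : {mfun T >-> R}) :
  alpha_cvg mu p f_ f -> cvg_in_measure mu f_ f.
Proof.
move=> [B [mB muBC intB]] delta delta0.
have p0 : 0 <= p by rewrite (le_trans _ hp).
have int0 : ((delta `^ p)^-1%:E *
    \int[mu]_(x in B n) (`|f_ n x - f x|%R `^ p)%:E @[n --> \oo] --> 0)%E.
  by rewrite -(mule0 (delta `^ p)^-1%:E); exact: cvgeZl.
have bound0 : ((delta `^ p)^-1%:E *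
    \int[mu]_(x in B n) (`|f_ n x - f x|%R `^ p)%:E + mu (~` B n)
    @[n --> \oo] --> 0)%E.
  by rewrite -[X in _ --> X]adde0; exact: cvgeD.
apply: squeeze_cvge (@cvg_cst _ _ _ _ _) bound0.
apply: nearW => n; rewrite measure_ge0/=.
by apply: measure_dist_ge_le => //; exact: measurable_funB.
Qed.
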